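(* Let $\bm z\in\mathcal Z_N^k$ and let $(\bm\omega_{\bm z},\bm B_{\bm z,\bm z},\bm\beta_{\bm z},\bm\eta,\bm\lambda_{\bm z},\pi)$ be an optimal solution to the reduced problem $(\mathrm R_{\bm z})$ given in the context. Define $\bar{\bm\beta}=(\bar{\bm\beta}^{(\ell)})\in\mathbb R^{N\times L}$, $\bar{\bm\omega}\in\mathbb R^N$ and $\bar{\bm\lambda}\in\mathbb R^N$ by $$ \bar{\bm\beta}^{(\ell)}_{\bm z}=\bm\beta^{(\ell)}_{\bm z},\qquad \bar{\bm\beta}^{(\ell)}_{\bm1-\bm z}=\hat{\bm\Sigma}_{\bm1-\bm z,\bm z}(\hat{\bm\Sigma}_{\bm z,\bm z})^{-1}\big(\bm\beta^{(\ell)}_{\bm z}-\eta^{(\ell)}\hat{\bm\mu}_{\bm z}\big)+\eta^{(\ell)}\hat{\bm\mu}_{\bm1-\bm z}\qquad(\forall\ell\in[L]), $$ $$ \bar{\bm\omega}_{\bm z}=\bm\omega_{\bm z},\qquad \bar{\bm\omega}_{\bm1-\bm z}=\Big[\sum_{\ell\in[L]}a^{(\ell)}\bar{\bm\beta}^{(\ell)}_{\bm1-\bm z}+\pi\bm1\Big]_+, $$ $$ \bar{\bm\lambda}_{\bm z}=\bm\lambda_{\bm z},\qquad \bar{\bm\lambda}_{\bm1-\bm z}=\hat{\bm\Sigma}_{\bm1-\bm z,\bm z}(\hat{\bm\Sigma}_{\bm z,\bm z})^{-1}\bm\lambda_{\bm z}. $$ Then there exists $\bar{\bm B}=(\bar{\bm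 B}^{(\ell)})\in\mathbb R^{N\times N\times L}$ such that $(\bar{\bm\omega},\bar{\bm B},\bar{\bm\beta},\bm\eta,\bar{\bm\lambda},\pi)$ is an optimal solution to the problem $(\mathrm D_{\bm z})$ given in the context. In addition, $f(\bm z)=f'(\bm z)$ for all $\bm z\in\mathcal Z_N^k$, where $f(\bm z)$ and $f'(\bm z)$ are the optimal values of $(\mathrm D_{\bm z})$ and $(\mathrm R_{\bm z})$, respectively.
   Context: Notation: $[N]=\{1,\dots,N\}$; $\bm X\succeq\bm Y$ ($\bm X\succ\bm Y$) means $\bm X-\bm Y$ is (symmetric and) positive semidefinite (positive definite); $\circ$ is the entrywise product; $\bm1$ is the all-ones vector of appropriate size; $\bm O$ is the zero matrix; vector inequalities are entrywise; $[\bm v]_+=(\max\{0,v_n\})_n$. For $\bm z\in\{0,1\}^N$ let $\mathcal N(\bm z)=\{n\in[N]:z_n=1\}$. For a vector $\bm v\in\mathbb R^N$, a matrix $\bm M\in\mathbb R^{N\times N}$ and $\bm z,\bm z'\in\{0,1\}^N$, $\bm v_{\bm z}=(v_n)_{n\in\mathcal N(\bm z)}$ is the subvector and $\bm M_{\bm z,\bm z'}=(M_{nn'})_{(n,n')\in\mathcal N(\bm z)\times\mathcal N(\bm z')}$ is the submatrix. Data: integers $N,L\ge1$ and $k\in[N]$; $\mathcal Z_N^k=\{\bm z\in\{0,1\}^N:\sum_{n\in[N]}z_n=k\}$; $a^{(\ell)},b^{(\ell)}\in\mathbb R$ for $\ell\in[L]$; $\gamma>0$; $\kappa_1\ge0$,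 $\kappa_2\ge1$; for observed $\bm\xi_1,\dots,\bm\xi_M\in\mathbb R^N$, $\hat{\bm\mu}=\frac1M\sum_{m\in[M]}\bm\xi_m$ and $\hat{\bm\Sigma}=\frac1M\sum_{m\in[M]}(\bm\xi_m-\hat{\bm\mu})(\bm\xi_m-\hat{\bm\mu})^\top$. Standing assumption: $\kappa_1>0$ and $\hat{\bm\Sigma}\succ\bm O$. Original problem $(\mathrm D_{\bm z})$, with optimal value $f(\bm z)$: $$ \begin{aligned} \max_{\bm\omega,\bm B,\bm\beta,\bm\eta,\bm\lambda,\pi}\quad & -\tfrac{\gamma}{2}\bm z^\top(\bm\omega\circ\bm\omega)-\sum_{\ell\in[L]}\eta^{(\ell)}b^{(\ell)}+\pi\\ \text{s.t.}\quad & \bm\omega\ge\sum_{\ell\in[L]}a^{(\ell)}\bm\beta^{(\ell)}+\pi\bm1,\\ & \sum_{\ell\in[L]}\bm B^{(\ell)}=\kappa_2\hat{\bm\Sigma}-\hat{\bm\mu}\hat{\bm\mu}^\top+\hat{\bm\mu}\Big(\sum_{\ell\in[L]}\bm\beta^{(\ell)}\Big)^\top+\Big(\sum_{\ell\in[L]}\bm\beta^{(\ell)}\Big)\hat{\bm\mu}^\top,\\ & \sum_{\ell\in[L]}\bm\beta^{(\ell)}=\bm\lambda+\hat{\bm\mu},\quad 1-\sum_{\ell\in[L]}\eta^{(\ell)}=0,\\ & \begin{pmatrix}\bm B^{(\ell)}&\bm\beta^{(\ell)}\\(\bm\beta^{(\ell)})^\top&\eta^{(\ell)}\end{pmatrix}\succeq\bm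 O\ (\forall\ell\in[L]),\quad\begin{pmatrix}\hat{\bm\Sigma}&\bm\lambda\\\bm\lambda^\top&\kappa_1\end{pmatrix}\succeq\bm O, \end{aligned} $$ with $\bm\omega,\bm\lambda\in\mathbb R^N$, $\bm B=(\bm B^{(\ell)})\in\mathbb R^{N\times N\times L}$, $\bm\beta=(\bm\beta^{(\ell)})\in\mathbb R^{N\times L}$, $\bm\eta=(\eta^{(\ell)})\in\mathbb R^L$, $\pi\in\mathbb R$. Reduced problem $(\mathrm R_{\bm z})$, with optimal value $f'(\bm z)$: $$ \begin{aligned} \max_{\bm\omega_{\bm z},\bm B_{\bm z,\bm z},\bm\beta_{\bm z},\bm\eta,\bm\lambda_{\bm z},\pi}\quad & -\tfrac{\gamma}{2}\bm\omega_{\bm z}^\top\bm\omega_{\bm z}-\sum_{\ell\in[L]}\eta^{(\ell)}b^{(\ell)}+\pi\\ \text{s.t.}\quad & \bm\omega_{\bm z}\ge\sum_{\ell\in[L]}a^{(\ell)}\bm\beta^{(\ell)}_{\bm z}+\pi\bm1,\\ & \sum_{\ell\in[L]}\bm B^{(\ell)}_{\bm z,\bm z}=\kappa_2\hat{\bm\Sigma}_{\bm z,\bm z}-\hat{\bm\mu}_{\bm z}\hat{\bm\mu}_{\bm z}^\top+\hat{\bm\mu}_{\bm z}\Big(\sum_{\ell\in[L]}\bm\beta^{(\ell)}_{\bm z}\Big)^\top+\Big(\sum_{\ell\in[L]}\bm\beta^{(\ell)}_{\bm z}\Big)\hat{\bm\mu}_{\bm z}^\top,\\ & \sum_{\ell\in[L]}\bm\beta^{(\ell)}_{\bm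 z}=\bm\lambda_{\bm z}+\hat{\bm\mu}_{\bm z},\quad 1-\sum_{\ell\in[L]}\eta^{(\ell)}=0,\\ & \begin{pmatrix}\bm B^{(\ell)}_{\bm z,\bm z}&\bm\beta^{(\ell)}_{\bm z}\\(\bm\beta^{(\ell)}_{\bm z})^\top&\eta^{(\ell)}\end{pmatrix}\succeq\bm O\ (\forall\ell\in[L]),\quad\begin{pmatrix}\hat{\bm\Sigma}_{\bm z,\bm z}&\bm\lambda_{\bm z}\\\bm\lambda_{\bm z}^\top&\kappa_1\end{pmatrix}\succeq\bm O, \end{aligned} $$ with decision variables $\bm\omega_{\bm z},\bm\lambda_{\bm z}\in\mathbb R^k$, $\bm B_{\bm z,\bm z}=(\bm B^{(\ell)}_{\bm z,\bm z})\in\mathbb R^{k\times k\times L}$, $\bm\beta_{\bm z}=(\bm\beta^{(\ell)}_{\bm z})\in\mathbb R^{k\times L}$, $\bm\eta=(\eta^{(\ell)})\in\mathbb R^L$, $\pi\in\mathbb R$ (vectors and matrices with subscript $\bm z$ are indexed by $\mathcal N(\bm z)$). *)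

(* Defs.v *)
From mathcomp Require Import all_boot all_order all_algebra.
From mathcomp Require Import classical_sets reals constructive_ereal ereal.

Set Implicit Arguments.
Unset Strict Implicit.
Unset Printing Implicit Defensive.

Import Order.TTheory GRing.Theory Num.Theory.
Local Open Scope ring_scope.
Local Open Scope classical_set_scope.

Section Matrices.
Variable R : realType.

Definition psd n (A : 'M[R]_n) : Prop :=
  A^T = A /\ forall x : 'cV[R]_n, 0 <= (x^T *m A *m x) 0 0.

Definition pd n (A : 'M[R]_n) : Prop :=
  A^T = A /\ forall x : 'cV[R]_n, x != 0 -> 0 < (x^T *m A *m x) 0 0.

Definition ones n : 'cV[R]_n := const_mx 1.

Definition hadamard m n (A B : 'M[R]_(m, n)) : 'M[R]_(m, n) :=
  map2_mx *%R A B.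

Definition vge n (u v : 'cV[R]_n) : Prop := forall i, v i 0 <= u i 0.

Definition pospart n (v : 'cV[R]_n) : 'cV[R]_n := map_mx (Num.max 0) v.

Definition bordered n (A : 'M[R]_n) (v : 'cV[R]_n) (t : R) : 'M[R]_(n + 1) :=
  block_mx A v v^T t%:M.

Definition sample_mean N M (xi : 'I_M -> 'cV[R]_N) : 'cV[R]_N :=
  M%:R^-1 *: \sum_(m < M) xi m.

Definition sample_cov N M (xi : 'I_M -> 'cV[R]_N) : 'M[R]_N :=
  M%:R^-1 *: \sum_(m < M)
    (xi m - sample_mean xi) *m (xi m - sample_mean xi)^T.

End Matrices.

Arguments ones {R n}.

Section Selection.
Variables (R : realType) (N : nat).
Implicit Types z : 'cV[R]_N.

Definition binary_vectors (k : nat) : set 'cV[R]_N :=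
  [set z | (forall n, z n 0 = 0 \/ z n 0 = 1) /\ \sum_(n < N) z n 0 = k%:R].

Definition selected z : {set 'I_N} := [set n | z n 0 == 1].

(* Vectors and matrices subscripted by z are indexed by 'I_#|selected z|,
   through the increasing enumeration [enum_val] of [selected z]. *)
Definition subv z (v : 'cV[R]_N) : 'cV[R]_#|selected z| :=
  \col_i v (enum_val i) 0.

Definition subm z z' (A : 'M[R]_N) : 'M[R]_(#|selected z|, #|selected z'|) :=
  \matrix_(i, j) A (enum_val i) (enum_val j).

(* A vector can be prescribed, in a unique way, by its subvectors for z
   and 1 - z. *)
Lemma subv_glue k z (u : 'cV[R]_#|selected z|)
    (w : 'cV[R]_#|selected (ones - z)|) :
  binary_vectors k z -> exists! v, subv z v = u /\ subv (ones - z) v = w.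
Proof.
move=> [zP _].
have selC n : (n \in selected (ones - z)) = (n \notin selected z).
  rewrite !inE !mxE; case: (zP n) => ->.
    by rewrite subr0 eqxx eq_sym oner_eq0.
  by rewrite subrr eqxx eq_sym oner_eq0.
exists (\col_n (\sum_(i | enum_val i == n) u i 0 +
                \sum_(j | enum_val j == n) w j 0)); split.
  split; apply/colP => i; rewrite !mxE.
    rewrite (big_pred1 i) => [|j]; last by rewrite (inj_eq enum_val_inj).
    rewrite big_pred0 ?addr0 // => j; apply/negP => /eqP eij.
    by have := enum_valP j; rewrite selC eij enum_valP.
  rewrite addrC (big_pred1 i) => [|j]; last by rewrite (inj_eq enum_val_inj).
  rewrite big_pred0 ?addr0 // => j; apply/negP => /eqP eij.
  by have := enum_valP i; rewrite selC -eij enum_valP.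
move=> v [<- <-]; apply/colP => n; rewrite !mxE.
have [zn|zn] := boolP (n \in selected z).
  rewrite (big_pred1 (enum_rank_in zn n)) => [|j].
    rewrite !mxE enum_rankK_in // big_pred0 ?addr0 // => j.
    by apply/negP => /eqP ejn; have := enum_valP j; rewrite selC ejn zn.
  by rewrite -{1}(enum_rankK_in zn zn) (inj_eq enum_val_inj).
have zn' : n \in selected (ones - z) by rewrite selC.
rewrite addrC (big_pred1 (enum_rank_in zn' n)) => [|j].
  rewrite !mxE enum_rankK_in // big_pred0 ?addr0 // => j.
  by apply/negP => /eqP ejn; have := enum_valP j; rewrite ejn (negPf zn).
by rewrite -{1}(enum_rankK_in zn' zn') (inj_eq enum_val_inj).
Qed.

End Selection.

Record variables (R : realType) (L n : nat) : Type := Variables {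
  v_omega : 'cV[R]_n;
  v_B : 'I_L -> 'M[R]_n;
  v_beta : 'I_L -> 'cV[R]_n;
  v_eta : 'I_L -> R;
  v_lambda : 'cV[R]_n;
  v_pi : R
}.

Section Problems.
Variables (R : realType) (L : nat).
Variables (a b : 'I_L -> R) (gamma kappa1 kappa2 : R).

(* The two problems have the same constraints, up to the data (mu, Sigma) and
   the dimension n: the original problem takes the full data, the reduced
   one takes mu_z and Sigma_{z,z}. *)
Definition feasible n (mu : 'cV[R]_n) (Sigma : 'M[R]_n) :
    set (variables R L n) :=
  [set x | let: Variables omega B beta eta lambda pi := x in
    vge omega (\sum_(l < L) a l *: beta l + pi *: ones) /\
    \sum_(l < L) B l =
      kappa2 *: Sigma - mu *m mu^T
      + mu *m (\sum_(l < L) beta l)^T + (\sum_(l < L) beta l) *m mu^T /\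
    \sum_(l < L) beta l = lambda + mu /\
    1 - \sum_(l < L) eta l = 0 /\
    (forall l, psd (bordered (B l) (beta l) (eta l))) /\
    psd (bordered Sigma lambda kappa1)].

Definition objective_orig N (z : 'cV[R]_N) (x : variables R L N) : R :=
  - (gamma / 2) * (z^T *m hadamard (v_omega x) (v_omega x)) 0 0
  - \sum_(l < L) v_eta x l * b l + v_pi x.

Definition objective_red n (x : variables R L n) : R :=
  - (gamma / 2) * ((v_omega x)^T *m v_omega x) 0 0
  - \sum_(l < L) v_eta x l * b l + v_pi x.

Definition maximizer T (F : set T) (g : T -> R) (x : T) : Prop :=
  F x /\ forall y, F y -> g y <= g x.

(* The supremum is taken in \bar R, so it exists without assuming that the
   problem is feasible, bounded, or attains its optimum. *)
Definition max_value T (F : set T) (g : T -> R) : \bar R :=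
  ereal_sup [set (g x)%:E | x in F].

Section Instances.
Variables (N : nat) (mu : 'cV[R]_N) (Sigma : 'M[R]_N) (z : 'cV[R]_N).

Definition orig_optimal : variables R L N -> Prop :=
  maximizer (feasible mu Sigma) (objective_orig z).

Definition orig_value : \bar R :=
  max_value (feasible mu Sigma) (objective_orig z).

Definition red_optimal : variables R L #|selected z| -> Prop :=
  maximizer (feasible (subv z mu) (subm z z Sigma)) (@objective_red _).

Definition red_value : \bar R :=
  max_value (feasible (subv z mu) (subm z z Sigma)) (@objective_red _).

End Instances.
End Problems.

(* Main.v *)
Require Import Defs.
From mathcomp Require Import all_boot all_order all_algebra.
From mathcomp Require boolp.
From mathcomp Require Import classical_sets reals constructive_ereal ereal.
From mathcomp Require Import ring.

(** Read a triple $(B^{(\ell)}, \beta^{(\ell)}, \eta^{(\ell)})$ with positive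
    semidefinite bordered matrix as the second moment, first moment and mass of
    a measure on the space of returns (or of a limit of such measures, when
    $\eta^{(\ell)} = 0$).  The equality constraints then say that the total
    mass is 1, that the total mean is $\mu + \lambda$, and that the total
    second moment centred at $\mu$ is $\kappa_2 \Sigma$.

    Such data can be pushed forward along an affine map $x \mapsto P x + w$,
    and positive multiples of a positive semidefinite $D$ can be added to the
    second moments, as centred independent noise would do.  This turns
    feasibility for $(\mu, \Sigma)$ into feasibility for
    $(P\mu + w, P\Sigma P^T + D)$; see [push_feasible].  Both directions
    between the two problems are instances.
    - Restriction to the selected assets: $P$ is the selection matrix $E$,
      $w = 0$ and $D = 0$ ([restrict_feasible]).
    - Extension from the selected assets: $P = \Sigma E^T \Sigma_{z,z}^{-1}$
      is the best linear predictor of all returns from the selected ones,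
      $w = \mu - P \mu_z$ makes the means agree, and $D$ is the covariance of
      the prediction error, that is the Schur complement of $\Sigma_{z,z}$
      ([extend_feasible]).  Since $E P = 1$, the selected coordinates are
      unchanged, and on the others one finds the formulas of the statement.

    The objective depends on $\omega$ through its selected coordinates only,
    and the remaining coordinates of $\omega$ can be taken as large as needed,
    so both passages preserve the objective.  Optimality of the extension and
    equality of the optimal values follow. *)

Set Implicit Arguments.
Unset Strict Implicit.
Unset Printing Implicit Defensive.

Import Order.TTheory GRing.Theory Num.Theory.
Local Open Scope ring_scope.
Local Open Scope classical_set_scope.

(** * Positive semidefinite matrices and congruence *)

Section PositiveSemidefinite.
Variable R : realType.

Lemma psd_congruence m n (P : 'M[R]_(m, n)) (A : 'M[R]_n) :
  psd A -> psd (P *m A *m P^T).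
Proof.
move=> [Asym Apos]; split=> [|x].
  by rewrite !trmx_mul trmxK Asym mulmxA.
by have := Apos (P^T *m x); rewrite trmx_mul trmxK !mulmxA.
Qed.

Lemma psdD n (A B : 'M[R]_n) : psd A -> psd B -> psd (A + B).
Proof.
move=> [Asym Apos] [Bsym Bpos]; split=> [|x].
  by rewrite linearD /= Asym Bsym.
by rewrite mulmxDr mulmxDl mxE addr_ge0.
Qed.

Lemma psdZ n c (A : 'M[R]_n) : 0 <= c -> psd A -> psd (c *: A).
Proof.
move=> c_ge0 [Asym Apos]; split=> [|x]; first by rewrite linearZ /= Asym.
by rewrite -scalemxAr -scalemxAl mxE mulr_ge0.
Qed.

Lemma psd0 n : psd (0 : 'M[R]_n).
Proof. by split=> [|x]; rewrite ?trmx0 // mulmx0 mul0mx mxE. Qed.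

Lemma pd_psd n (A : 'M[R]_n) : pd A -> psd A.
Proof.
move=> [Asym Apos]; split=> // x.
have [->|x_neq0] := eqVneq x 0; last exact/ltW/Apos.
by rewrite mulmx0 mxE.
Qed.

Lemma pd_unitmx n (A : 'M[R]_n) : pd A -> A \in unitmx.
Proof.
move=> [_ Apos]; rewrite -row_free_unit -kermx_eq0.
apply: contraT => /rowV0Pn[v /sub_kermxP vA0 v_neq0].
have := Apos v^T; rewrite trmxK vA0 mul0mx mxE ltxx; apply.
by rewrite trmx_eq0.
Qed.

(** Injectivity of $P^T$ is what keeps the congruence definite; it is given
    here by a right inverse of $P$. *)
Lemma pd_congruence m n (P : 'M[R]_(m, n)) (Q : 'M[R]_(n, m)) (A : 'M[R]_n) :
  P *m Q = 1%:M -> pd A -> pd (P *m A *m P^T).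
Proof.
move=> PQ1 [Asym Apos]; split=> [|x x_neq0].
  by rewrite !trmx_mul trmxK Asym mulmxA.
have Px_neq0 : P^T *m x != 0.
  apply: contra_neq x_neq0 => Px0.
  by rewrite -[x]mul1mx -trmx1 -PQ1 trmx_mul -mulmxA Px0 mulmx0.
by have := Apos _ Px_neq0; rewrite trmx_mul trmxK !mulmxA.
Qed.

(** If a measure has second moment [A], first moment [v] and mass [t], this is
    the second moment of its image under $x \mapsto P x + w$; the first moment
    becomes $P v + t w$. *)
Definition push_moment m n (P : 'M[R]_(m, n)) (w : 'cV[R]_m)
    (A : 'M[R]_n) (v : 'cV[R]_n) (t : R) : 'M[R]_m :=
  P *m A *m P^T + (P *m v) *m w^T + w *m (P *m v)^T + t *: (w *m w^T).

(** The affine map is linear in homogeneous coordinates, where the bordered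
    matrix transforms by congruence. *)
Lemma bordered_push m n (P : 'M[R]_(m, n)) (w : 'cV[R]_m)
    (A : 'M[R]_n) (v : 'cV[R]_n) (t : R) :
  let Q := block_mx P w 0 1%:M in
  bordered (push_moment P w A v t) (P *m v + t *: w) t =
  Q *m bordered A v t *m Q^T.
Proof.
move=> Q; rewrite /Q /bordered tr_block_mx !mulmx_block !trmx0 !trmx1.
rewrite !mul0mx !mulmx0 !mulmx1 !mul1mx !add0r mul_mx_scalar.
congr block_mx.
- rewrite /push_moment trmx_mul mulmxDl mulmxDl -scalemxAl mulmxA addrA.
  by rewrite -!addrA; congr (_ + _); rewrite !addrA; congr (_ + _); rewrite addrC.
- by rewrite linearD linearZ /= trmx_mul mul_scalar_mx.
Qed.

Lemma push_moment_sum L m n (P : 'M[R]_(m, n)) (w : 'cV[R]_m)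
    (A : 'I_L -> 'M[R]_n) (v : 'I_L -> 'cV[R]_n) (t : 'I_L -> R) :
  push_moment P w (\sum_(l < L) A l) (\sum_(l < L) v l) (\sum_(l < L) t l) =
  \sum_(l < L) push_moment P w (A l) (v l) (t l).
Proof.
rewrite /push_moment linear_sum !mulmx_sumr !mulmx_suml /= linear_sum.
by rewrite mulmx_sumr scaler_suml -!big_split.
Qed.

Lemma psd_bordered_push m n (P : 'M[R]_(m, n)) (w : 'cV[R]_m)
    (A : 'M[R]_n) (v : 'cV[R]_n) (t : R) (D : 'M[R]_m) :
  psd (bordered A v t) -> psd D ->
  psd (bordered (push_moment P w A v t + D) (P *m v + t *: w) t).
Proof.
move=> Apsd Dpsd.
have -> : bordered (push_moment P w A v t + D) (P *m v + t *: w) t =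
    bordered (push_moment P w A v t) (P *m v + t *: w) t +
    col_mx 1%:M 0 *m D *m (col_mx 1%:M 0)^T.
  rewrite /bordered tr_col_mx trmx1 trmx0 mul_col_mx mul_col_mx !mul_mx_row.
  by rewrite !mul1mx !mul0mx !mulmx0 mulmx1 add_block_mx !addr0.
apply: psdD; last exact: psd_congruence.
by rewrite bordered_push; apply: psd_congruence.
Qed.

End PositiveSemidefinite.

(** * Transport of feasibility along affine maps *)

Section Push.
Variables (R : realType) (L : nat).
Variables (a : 'I_L -> R) (kappa1 kappa2 : R).

(** For mean [s], the prescribed total second moment is the one whose value
    centred at [mu] is [kappa2 *: Sigma].  Centred moments do not see the
    translation [w], so the prescription is preserved by affine maps. *)
Lemma push_total_moment m n (P : 'M[R]_(m, n)) (w : 'cV[R]_m)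
    (mu s : 'cV[R]_n) (Sigma : 'M[R]_n) :
  let nu := P *m mu + w in let r := P *m s + w in
  push_moment P w
    (kappa2 *: Sigma - mu *m mu^T + mu *m s^T + s *m mu^T) s 1 =
  kappa2 *: (P *m Sigma *m P^T) - nu *m nu^T + nu *m r^T + r *m nu^T.
Proof.
move=> nu r.
rewrite /push_moment !mulmxDr !mulmxDl mulmxN mulNmx.
rewrite -scalemxAr -scalemxAl scale1r.
have PP (x y : 'cV[R]_n) : P *m (x *m y^T) *m P^T = (P *m x) *m (P *m y)^T.
  by rewrite trmx_mul !mulmxA.
rewrite !PP /nu /r; move: (P *m mu) (P *m s) (P *m Sigma *m P^T) => u v K.
by apply/matrixP => i j; rewrite !(mxE, big_ord1); ring.
Qed.

Lemma push_feasible m n (P : 'M[R]_(m, n)) (w : 'cV[R]_m)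
    (mu : 'cV[R]_n) (Sigma : 'M[R]_n) (D : 'M[R]_m) omega B beta eta lambda pi
    (omega' : 'cV[R]_m) :
  (0 < L)%N -> 0 <= kappa2 -> psd D ->
  feasible a kappa1 kappa2 mu Sigma (Variables omega B beta eta lambda pi) ->
  let beta' l := P *m beta l + eta l *: w in
  vge omega' (\sum_(l < L) a l *: beta' l + pi *: ones) ->
  exists B',
    feasible a kappa1 kappa2 (P *m mu + w) (P *m Sigma *m P^T + D)
      (Variables omega' B' beta' eta (P *m lambda) pi).
Proof.
move=> L_gt0 kappa2_ge0 Dpsd [_ [sumB [sumbeta [sumeta [Bpsd lambdapsd]]]]].
move=> beta' homega'.
have eta1 : \sum_(l < L) eta l = 1 by apply/esym/eqP; rewrite -subr_eq0 sumeta.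
have sumbeta' : \sum_(l < L) beta' l = P *m (\sum_(l < L) beta l) + w.
  by rewrite big_split -mulmx_sumr -scaler_suml eta1 scale1r.
(* The noise is shared evenly among the L measures. *)
exists (fun l => push_moment P w (B l) (beta l) (eta l) + (kappa2 / L%:R) *: D).
split=> //; split; last split; last split=> //; last split.
- rewrite big_split /= sumr_const card_ord -scaler_nat scalerA mulrC divfK;
    last by rewrite pnatr_eq0 -lt0n.
  rewrite -push_moment_sum eta1 sumB push_total_moment sumbeta' scalerDr.
  by rewrite !(addrAC _ _ (kappa2 *: D)).
- by rewrite sumbeta' sumbeta mulmxDr addrA.
- by move=> l; apply: psd_bordered_push => //; apply: psdZ; rewrite ?divr_ge0.
- have := psd_bordered_push P 0 lambdapsd Dpsd.
  by rewrite /push_moment trmx0 !mulmx0 !mul0mx !scaler0 !addr0.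
Qed.

End Push.

(** * Selection of coordinates *)

Section SelectionMatrix.
Variables (R : realType) (N k : nat).
Implicit Types z : 'cV[R]_N.

Definition selection_mx z : 'M[R]_(#|selected z|, N) :=
  rowsub (fun i => enum_val i) 1%:M.

Lemma subvE z (v : 'cV[R]_N) : subv z v = selection_mx z *m v.
Proof. by rewrite mul_rowsub_mx mul1mx; apply/colP => i; rewrite !mxE. Qed.

Lemma submE z z' (A : 'M[R]_N) :
  subm z z' A = selection_mx z *m A *m (selection_mx z')^T.
Proof.
rewrite mul_rowsub_mx mul1mx trmx_mxsub trmx1 -[mxsub id _ _]/(colsub _ _).
by rewrite mulmx_colsub mulmx1; apply/matrixP => i j; rewrite !mxE.
Qed.

Lemma selection_mxK z : selection_mx z *m (selection_mx z)^T = 1%:M.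
Proof.
apply/matrixP => i j; rewrite -[X in X *m _]mulmx1 -submE !mxE.
by rewrite (inj_eq enum_val_inj).
Qed.

Lemma selectedC z n :
  binary_vectors k z -> (n \in selected (ones - z)) = (n \notin selected z).
Proof.
move=> [zP _]; rewrite !inE !mxE; case: (zP n) => ->.
  by rewrite subr0 eqxx eq_sym oner_eq0.
by rewrite subrr eqxx eq_sym oner_eq0.
Qed.

(** Together, the two enumerations reach every coordinate; this is what lets a
    vector be studied through its subvectors for [z] and [ones - z]. *)
Lemma coord_ind z (Q : 'I_N -> Prop) :
  binary_vectors k z ->
  (forall i : 'I_#|selected z|, Q (enum_val i)) ->
  (forall j : 'I_#|selected (ones - z)|, Q (enum_val j)) ->
  forall n, Q n.
Proof.
move=> zbin Qz QzC n; have [zn|] := boolP (n \in selected z).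
  by rewrite -(enum_rankK_in zn zn).
by rewrite -(selectedC _ zbin) => zn; rewrite -(enum_rankK_in zn zn).
Qed.

Lemma subv_inj2 z (u v : 'cV[R]_N) :
  binary_vectors k z ->
  subv z u = subv z v -> subv (ones - z) u = subv (ones - z) v -> u = v.
Proof.
move=> zbin /colP uvz /colP uvzC; apply/colP; apply: (coord_ind zbin) => i.
  by have := uvz i; rewrite !mxE.
by have := uvzC i; rewrite !mxE.
Qed.

Lemma vge_split z (u v : 'cV[R]_N) :
  binary_vectors k z ->
  vge (subv z u) (subv z v) -> vge (subv (ones - z) u) (subv (ones - z) v) ->
  vge u v.
Proof.
move=> zbin uvz uvzC; apply: (coord_ind zbin) => i.
  by have := uvz i; rewrite !mxE.
by have := uvzC i; rewrite !mxE.
Qed.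

Lemma subv_vge z (u v : 'cV[R]_N) : vge u v -> vge (subv z u) (subv z v).
Proof. by move=> uv i; rewrite !mxE. Qed.

Lemma subv_affine L z (c : 'I_L -> R) (v : 'I_L -> 'cV[R]_N) t :
  subv z (\sum_(l < L) c l *: v l + t *: ones) =
  \sum_(l < L) c l *: subv z (v l) + t *: ones.
Proof.
apply/colP => i; rewrite !(mxE, summxE); congr (_ + _).
by apply: eq_bigr => l _; rewrite !mxE.
Qed.

Lemma pospart_vge n (v : 'cV[R]_n) : vge (pospart v) v.
Proof. by move=> i; rewrite mxE le_max lexx orbT. Qed.

(** A binary weight keeps exactly the selected squares. *)
Lemma objective_restrict L (b : 'I_L -> R) gamma z (x : variables R L N)
    (y : variables R L #|selected z|) :
  binary_vectors k z ->
  subv z (v_omega x) = v_omega y -> v_eta x = v_eta y -> v_pi x = v_pi y ->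
  objective_orig b gamma z x = objective_red b gamma y.
Proof.
rewrite /objective_orig /objective_red => -[zP _] <- -> ->.
congr (_ * _ - _ + _); rewrite !mxE.
rewrite [LHS](bigID [in selected z]) /= [X in _ + X]big1 ?addr0 => [|n]; last first.
  by rewrite inE !mxE; case: (zP n) => ->; rewrite ?eqxx // mul0r.
rewrite big_enum_val /=; apply: eq_bigr => i _.
by have := enum_valP i; rewrite inE !mxE => /eqP ->; rewrite mul1r.
Qed.

End SelectionMatrix.

(** * Restriction and extension of feasible points *)

Section Transfer.
Variables (R : realType) (N L k : nat).
Variables (a : 'I_L -> R) (kappa1 kappa2 : R).
Variables (mu : 'cV[R]_N) (Sigma : 'M[R]_N) (z : 'cV[R]_N).
Hypotheses (L_gt0 : (0 < L)%N) (kappa2_ge0 : 0 <= kappa2).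
Hypotheses (Sigma_pd : pd Sigma) (zbin : binary_vectors k z).

Let E := selection_mx z.
Let Szz := subm z z Sigma.

(** The mean deviation of the restricted point is $E\lambda$, but only [omega]
    and the scalars enter the objective, so the rest is left existential. *)
Lemma restrict_feasible omega B beta eta lambda pi :
  feasible a kappa1 kappa2 mu Sigma (Variables omega B beta eta lambda pi) ->
  exists B' beta' lambda',
    feasible a kappa1 kappa2 (subv z mu) Szz
      (Variables (subv z omega) B' beta' eta lambda' pi).
Proof.
move=> xfeas.
have [|B' feasB'] := push_feasible (P := E) (w := 0) (omega' := subv z omega)
    L_gt0 kappa2_ge0 (psd0 R _) xfeas.
  under eq_bigr do rewrite scaler0 addr0 -subvE.
  by rewrite -subv_affine; apply: subv_vge; case: xfeas.
rewrite !addr0 -submE -subvE in feasB'.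
by exists B', (fun l => E *m beta l + eta l *: 0), (E *m lambda).
Qed.

(** The best linear predictor of all coordinates from the selected ones. *)
Definition regression_mx : 'M[R]_(N, #|selected z|) :=
  Sigma *m E^T *m invmx Szz.

Let P := regression_mx.

Lemma subm_pd : pd Szz.
Proof. by rewrite /Szz submE; apply: pd_congruence (selection_mxK z) Sigma_pd. Qed.

Let Szz_unit : Szz \in unitmx := pd_unitmx subm_pd.

Lemma subv_regression (v : 'cV[R]_#|selected z|) : subv z (P *m v) = v.
Proof.
by rewrite subvE /P /regression_mx !mulmxA -submE mulmxV // mul1mx.
Qed.

Lemma subvC_regression (v : 'cV[R]_#|selected z|) :
  subv (ones - z) (P *m v) = subm (ones - z) z Sigma *m invmx Szz *m v.
Proof. by rewrite subvE submE /P /regression_mx !mulmxA. Qed.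

(** The difference is the covariance $(1 - P E) \Sigma (1 - P E)^T$ of the
    prediction error. *)
Lemma psd_residual : psd (Sigma - P *m Szz *m P^T).
Proof.
have Ssym : Sigma^T = Sigma by case: Sigma_pd.
have Szzsym : Szz^T = Szz by case: subm_pd.
have PT : P^T = invmx Szz *m E *m Sigma.
  by rewrite /P /regression_mx !trmx_mul trmxK Ssym trmx_inv Szzsym mulmxA.
have PSzz : P *m Szz = Sigma *m E^T.
  by rewrite /P /regression_mx -mulmxA mulVmx // mulmx1.
have PES : P *m E *m Sigma = P *m Szz *m P^T.
  by rewrite PSzz PT /P /regression_mx !mulmxA.
have SEP : Sigma *m (P *m E)^T = P *m Szz *m P^T.
  by rewrite PSzz trmx_mul mulmxA.
have PESEP : P *m E *m Sigma *m (P *m E)^T = P *m Szz *m P^T.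
  by rewrite trmx_mul /Szz submE !mulmxA.
have -> : Sigma - P *m Szz *m P^T =
    (1%:M - P *m E) *m Sigma *m (1%:M - P *m E)^T.
  rewrite mulmxBl mul1mx [(_ - _)^T]linearB /= trmx1 mulmxBr mulmx1 mulmxBl.
  by rewrite SEP PESEP PES subrr subr0.
exact/psd_congruence/pd_psd.
Qed.

Lemma extend_feasible omega B beta eta lambda pi
    (betabar : 'I_L -> 'cV[R]_N) (omegabar lambdabar : 'cV[R]_N) :
  feasible a kappa1 kappa2 (subv z mu) Szz
    (Variables omega B beta eta lambda pi) ->
  (forall l, subv z (betabar l) = beta l) ->
  (forall l, subv (ones - z) (betabar l) =
     subm (ones - z) z Sigma *m invmx Szz *m (beta l - eta l *: subv z mu)
     + eta l *: subv (ones - z) mu) ->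
  subv z omegabar = omega ->
  subv (ones - z) omegabar =
    pospart (\sum_(l < L) a l *: subv (ones - z) (betabar l) + pi *: ones) ->
  subv z lambdabar = lambda ->
  subv (ones - z) lambdabar =
    subm (ones - z) z Sigma *m invmx Szz *m lambda ->
  exists Bbar,
    feasible a kappa1 kappa2 mu Sigma
      (Variables omegabar Bbar betabar eta lambdabar pi).
Proof.
move=> xfeas betaz betazC omegaz omegazC lambdaz lambdazC.
pose w := mu - P *m subv z mu.
have subvD z' (u v : 'cV[R]_N) : subv z' (u + v) = subv z' u + subv z' v.
  by rewrite !subvE mulmxDr.
have subvZ z' c (v : 'cV[R]_N) : subv z' (c *: v) = c *: subv z' v.
  by rewrite !subvE -scalemxAr.
(* The prescribed coordinates are those of an affine prediction from [beta]. *)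
have betabarE : betabar = fun l => P *m beta l + eta l *: w.
  apply/boolp.funext => l.
  have -> : P *m beta l + eta l *: w =
      P *m (beta l - eta l *: subv z mu) + eta l *: mu.
    by rewrite mulmxBr -scalemxAr scalerBr -addrA [_ - _ in LHS]addrC.
  apply: (subv_inj2 zbin); rewrite subvD subvZ.
    by rewrite subv_regression subrK betaz.
  by rewrite subvC_regression betazC.
have -> : lambdabar = P *m lambda.
  apply: (subv_inj2 zbin); first by rewrite subv_regression.
  by rewrite subvC_regression.
have [|Bbar feasBbar] := push_feasible (P := P) (w := w) (omega' := omegabar)
    L_gt0 kappa2_ge0 psd_residual xfeas.
  have -> : \sum_(l < L) a l *: (P *m beta l + eta l *: w) + pi *: ones =
      \sum_(l < L) a l *: betabar l + pi *: ones by rewrite betabarE.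
  apply: (vge_split zbin); rewrite subv_affine.
    by rewrite omegaz (eq_bigr _ (fun l _ => congr1 _ (betaz l))); case: xfeas.
  by rewrite omegazC; apply: pospart_vge.
by exists Bbar; rewrite betabarE; move: feasBbar; rewrite /w !subrKC.
Qed.

End Transfer.

Lemma max_value_le (R : realType) T U (F : set T) (G : set U)
    (g : T -> R) (h : U -> R) :
  (forall x, F x -> exists2 y, G y & h y = g x) ->
  (max_value F g <= max_value G h)%E.
Proof.
move=> FG; apply: ge_ereal_sup => _ [x /FG[y Gy <-] <-].
by apply: ereal_sup_ubound; exists y.
Qed.

Theorem theorem6 (R : realType) (N L k M : nat)
    (hN : (1 <= N)%N) (hL : (1 <= L)%N) (hk : (1 <= k <= N)%N) (hM : (1 <= M)%N)
    (a b : 'I_L -> R) (gamma kappa1 kappa2 : R) (xi : 'I_M -> 'cV[R]_N)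
    (mu : 'cV[R]_N) (Sigma : 'M[R]_N)
    (hmu : mu = sample_mean xi) (hSigma : Sigma = sample_cov xi)
    (hgamma : 0 < gamma) (hkappa1 : 0 < kappa1) (hkappa2 : 1 <= kappa2)
    (hSigma_pd : pd Sigma) :
  (forall (z : 'cV[R]_N), binary_vectors k z ->
   forall (omega : 'cV[R]_#|selected z|)
     (B : 'I_L -> 'M[R]_#|selected z|) (beta : 'I_L -> 'cV[R]_#|selected z|)
     (eta : 'I_L -> R) (lambda : 'cV[R]_#|selected z|) (pi : R),
   red_optimal a b gamma kappa1 kappa2 mu Sigma
     (Variables omega B beta eta lambda pi) ->
   forall (betabar : 'I_L -> 'cV[R]_N) (omegabar lambdabar : 'cV[R]_N),
   (forall l, subv z (betabar l) = beta l) ->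
   (forall l, subv (ones - z) (betabar l) =
      subm (ones - z) z Sigma *m invmx (subm z z Sigma)
        *m (beta l - eta l *: subv z mu)
      + eta l *: subv (ones - z) mu) ->
   subv z omegabar = omega ->
   subv (ones - z) omegabar =
     pospart (\sum_(l < L) a l *: subv (ones - z) (betabar l) + pi *: ones) ->
   subv z lambdabar = lambda ->
   subv (ones - z) lambdabar =
     subm (ones - z) z Sigma *m invmx (subm z z Sigma) *m lambda ->
   exists Bbar : 'I_L -> 'M[R]_N,
     orig_optimal a b gamma kappa1 kappa2 mu Sigma z
       (Variables omegabar Bbar betabar eta lambdabar pi))
  /\
  (forall z : 'cV[R]_N, binary_vectors k z ->
   orig_value a b gamma kappa1 kappa2 mu Sigma z =
   red_value a b gamma kappa1 kappa2 mu Sigma z).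
Proof.
have kappa2_ge0 : 0 <= kappa2 := le_trans ler01 hkappa2.
split=> z zbin.
  move=> omega B beta eta lambda pi [xfeas xmax].
  move=> betabar omegabar lambdabar betaz betazC omegaz omegazC lambdaz lambdazC.
  have [Bbar barfeas] := extend_feasible hL kappa2_ge0 hSigma_pd zbin
    xfeas betaz betazC omegaz omegazC lambdaz lambdazC.
  exists Bbar; split=> // -[omega' B' beta' eta' lambda' pi'] yfeas.
  have [B2 [beta2 [lambda2 y2feas]]] :=
    restrict_feasible z hL kappa2_ge0 yfeas.
  set x := Variables omegabar _ _ _ _ _; set y := Variables omega' _ _ _ _ _.
  have -> : objective_orig b gamma z x = objective_red b gamma
    (Variables omega B beta eta lambda pi) by exact: objective_restrict zbin _ _ _.
  have -> : objective_orig b gamma z y = objective_red b gamma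
    (Variables (subv z omega') B2 beta2 eta' lambda2 pi')
    by exact: objective_restrict zbin _ _ _.
  exact: xmax.
apply/eqP; rewrite eq_le; apply/andP; split; apply: max_value_le.
  move=> [omega B beta eta lambda pi] xfeas.
  have [B' [beta' [lambda' yfeas]]] := restrict_feasible z hL kappa2_ge0 xfeas.
  by exists (Variables (subv z omega) B' beta' eta lambda' pi) => //;
    apply: esym; exact: objective_restrict zbin _ _ _.
move=> [omega B beta eta lambda pi] xfeas.
have [betabar betabarP] := boolp.choice (fun l =>
  subv_glue (beta l)
    (subm (ones - z) z Sigma *m invmx (subm z z Sigma)
       *m (beta l - eta l *: subv z mu) + eta l *: subv (ones - z) mu) zbin).
have betaz l := (betabarP l).1.1; have betazC l := (betabarP l).1.2.
have [omegabar [[omegaz omegazC] _]] := subv_glue omega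
  (pospart (\sum_(l < L) a l *: subv (ones - z) (betabar l) + pi *: ones)) zbin.
have [lambdabar [[lambdaz lambdazC] _]] := subv_glue lambda
  (subm (ones - z) z Sigma *m invmx (subm z z Sigma) *m lambda) zbin.
have [Bbar barfeas] := extend_feasible hL kappa2_ge0 hSigma_pd zbin
  xfeas betaz betazC omegaz omegazC lambdaz lambdazC.
by exists (Variables omegabar Bbar betabar eta lambdabar pi) => //;
  exact: objective_restrict zbin _ _ _.
Qed.
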